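(* Let $\mathbf A=(A_1,\dots,A_n)$ be a doubly stochastic $n$-tuple which is a local minimizer of the mixed discriminant $D$ on the set $D_n$ of doubly stochastic $n$-tuples. Then there exist a hermitian $n\times n$ matrix $R$ and real scalars $\mu_1,\dots,\mu_n$ such that for each $1\le i\le n$ $$Q_i=R+\mu_i I+P_i,$$ where $P_i$ is positive semidefinite and $A_iP_i=P_iA_i=0$.
   Context: A doubly stochastic $n$-tuple is $\mathbf A=(A_1,\dots,A_n)$ of $n\times n$ complex hermitian positive semidefinite matrices with $\operatorname{tr}A_i=1$ for all $i$ and $\sum_i A_i=I$; $D_n$ is the set of these, viewed as a subset of the real vector space $H_n\oplus\cdots\oplus H_n$ ($n$ copies), where $H_n$ is the real vector space of $n\times n$ hermitian matrices with inner product $\langle A,B\rangle=\operatorname{tr}(AB)$; ''local minimizer'' refers to this space. The mixed discriminant is $D(A_1,\dots,A_n)=\frac{\partial^n}{\partial t_1\cdots\partial t_n}\det(t_1A_1+\cdots+t_nA_n)$. For $1\le i\le n$, $Q_i=(\partial D/\partial A_i)^T$ is the (unique) $n\times n$ matrix such that $D(A_1,\dots,A_{i-1},X,A_{i+1},\dots,A_n)=\operatorname{tr}(XQ_i)$ for all $n\times n$ complex matrices $X$; it is hermitian when all $A_j$ are hermitian. *)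

(* Defs.v *)
From HB Require Import structures.
From mathcomp Require Import all_boot all_order all_fingroup all_algebra.
From mathcomp Require Import complex mpoly reals.

Set Implicit Arguments.
Unset Strict Implicit.
Unset Printing Implicit Defensive.

Import GRing.Theory Num.Theory.
Local Open Scope ring_scope.
Local Open Scope complex_scope.
Local Open Scope sesquilinear_scope.

Section MixedDiscriminant.
Variables (C : comNzRingType) (n : nat).
Implicit Types (A : 'I_n -> 'M[C]_n) (i : 'I_n) (X Q : 'M[C]_n).

Definition det_pencil A : {mpoly C[n]} :=
  \det (\sum_i 'X_i *: map_mx (@mpolyC n C) (A i)).

(* The n-th order derivative is a constant polynomial (mderiv_det_pencil);
   [mixed_disc A] is that constant. *)
Definition mixed_disc A : C :=
  (mderivm [multinom 1%N | _ < n] (det_pencil A))@_0.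

Definition replace A i X : 'I_n -> 'M[C]_n :=
  fun j => if j == i then X else A j.

(* Q represents X |-> D(A_1, .., X, .., A_n), with X in position i, through
   the trace pairing. Such a Q exists and is unique (mixed_grad_exists_unique). *)
Definition is_mixed_grad A i Q : Prop :=
  forall X, mixed_disc (replace A i X) = \tr (X *m Q).

Let term A (s : 'S_n) (f : {ffun 'I_n -> 'I_n}) : C :=
  (-1) ^+ s * \prod_k A (f k) k (s k).

Let mon (f : {ffun 'I_n -> 'I_n}) : 'X_{1..n} := (\sum_k U_(f k))%MM.

Let det_pencilE A :
  det_pencil A = \sum_s \sum_f term A s f *: 'X_[mon f].
Proof.
rewrite /det_pencil /determinant; apply: eq_bigr => s _.
under eq_bigr => k _ do rewrite summxE.
rewrite bigA_distr_bigA mulr_sumr; apply: eq_bigr => f _.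
under eq_bigr => k _ do rewrite !mxE mulrC.
rewrite big_split /= mprodXE /term -mul_mpolyC mpolyCM rmorphXn rmorphN1.
by rewrite rmorph_prod mulrA.
Qed.

Let mderiv_mon (f : {ffun 'I_n -> 'I_n}) :
  mderivm [multinom 1%N | _ < n] 'X_[mon f] =
  (injectiveb f)%:R%:MP :> {mpoly C[n]}.
Proof.
rewrite mderivmX.
under eq_bigr => i _ do rewrite mnmE ffactn1.
case: (boolP (injectiveb f)) => [/injectiveP inj_f | ninj_f].
  suff -> : mon f = [multinom 1%N | _ < n].
    rewrite big1 => [|i _]; last by rewrite mnmE.
    rewrite scale1r mpolyC1 -mpolyX0; congr 'X_[_].
    by apply/mnmP=> i; rewrite mnmBE mnm0E subnn.
  apply/mnmP=> i; rewrite mnmE mnm_sumE.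
  have [g _ gK] := injF_bij inj_f.
  rewrite (bigD1 (g i)) //= mnm1E gK eqxx big1 // => k /eqP nk; rewrite mnm1E.
  by case: eqP => // fk; case: nk; apply: inj_f; rewrite gK.
have [i fNi] : exists i, forall k, f k != i.
  apply/'exists_forallP; apply: contraNT ninj_f => /existsPn h.
  have img_f : f @: [set: 'I_n] = [set: 'I_n].
    apply/setP=> i; have := h i; rewrite inE negb_forall => /existsP[k].
    by rewrite negbK => /eqP <-; rewrite imset_f ?inE.
  have /imset_injP inj_f : #|f @: [set: 'I_n]| == #|[set: 'I_n]| by rewrite img_f.
  by apply/injectiveP=> x y; apply: inj_f; rewrite inE.
rewrite (bigD1 i) //= mnm_sumE big1 ?mul0n ?scale0r ?mpolyC0 //.
by move=> k _; rewrite mnm1E (negbTE (fNi k)).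
Qed.

Let mderiv_det_pencil_sum A :
  mderivm [multinom 1%N | _ < n] (det_pencil A) =
  (\sum_s \sum_(f : {ffun _} | injectiveb f) term A s f)%:MP.
Proof.
rewrite det_pencilE !raddf_sum; apply: eq_bigr => s _.
rewrite !raddf_sum /= [RHS]big_mkcond; apply: eq_bigr => f _.
rewrite mderivmZ mderiv_mon -mul_mpolyC -mpolyCM.
by case: ifP; rewrite ?mulr1 ?mulr0 ?mpolyC0.
Qed.

Lemma mixed_discE A :
  mixed_disc A =
  \sum_(s : 'S_n) \sum_(f : {ffun 'I_n -> 'I_n} | injectiveb f)
    (-1) ^+ s * \prod_k A (f k) k (s k).
Proof. by rewrite /mixed_disc mderiv_det_pencil_sum mcoeffC eqxx mulr1. Qed.

Lemma mderiv_det_pencil A :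
  mderivm [multinom 1%N | _ < n] (det_pencil A) = (mixed_disc A)%:MP.
Proof. by rewrite mixed_discE -mderiv_det_pencil_sum. Qed.

Lemma mixed_disc_replaceE A i X :
  mixed_disc (replace A i X) =
  \sum_a \sum_b X a b * mixed_disc (replace A i (delta_mx a b)).
Proof.
rewrite mixed_discE.
under [RHS]eq_bigr => a _ do under eq_bigr => b _ do rewrite mixed_discE mulr_sumr.
under [RHS]eq_bigr => a _ do rewrite exchange_big /=.
rewrite [RHS]exchange_big /=; apply: eq_bigr => s _.
under [RHS]eq_bigr => a _ do under eq_bigr => b _ do rewrite mulr_sumr.
under [RHS]eq_bigr => a _ do rewrite exchange_big /=.
rewrite [RHS]exchange_big /=; apply: eq_bigr => f /injectiveP inj_f.
have [g _ gK] := injF_bij inj_f; set k := g i.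
have prodE Y : \prod_j replace A i Y (f j) j (s j) =
    Y k (s k) * \prod_(j | j != k) A (f j) j (s j).
  rewrite (bigD1 k) //= {1}/replace gK eqxx; congr (_ * _).
  apply: eq_bigr => j /eqP nj; rewrite /replace; case: eqP => // fj.
  by case: nj; apply: inj_f; rewrite gK.
rewrite prodE [RHS](bigD1 k) //= [X in _ = X + _](bigD1 (s k)) //= !prodE.
rewrite mxE !eqxx mul1r.
rewrite [X in _ = _ + X + _]big1 ?addr0; last first.
  move=> b bk; rewrite prodE mxE eqxx [_ == b]eq_sym (negbTE bk) /=.
  by rewrite mul0r !mulr0.
rewrite [X in _ = _ + X]big1 ?addr0 => [|a ak]; first by rewrite mulrCA.
by apply: big1 => b _; rewrite prodE mxE [_ == a]eq_sym (negbTE ak) !mul0r !mulr0.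
Qed.

Lemma mixed_grad_exists_unique A i : exists! Q, is_mixed_grad A i Q.
Proof.
have trE X Q : \tr (X *m Q) = \sum_a \sum_b X a b * Q b a.
  by apply: eq_bigr => a _; rewrite mxE.
exists (\matrix_(b, a) mixed_disc (replace A i (delta_mx a b))); split.
  move=> X; rewrite mixed_disc_replaceE trE.
  by apply: eq_bigr => a _; apply: eq_bigr => b _; rewrite mxE.
move=> Q hQ; apply/matrixP=> b a; rewrite mxE hQ trE.
rewrite (bigD1 a) //= (bigD1 b) //= !mxE !eqxx mul1r.
rewrite [X in _ + X + _]big1 ?addr0; last first.
  by move=> b' /negbTE hb; rewrite mxE hb andbF mul0r.
rewrite big1 ?addr0 // => a' /negbTE ha.
by apply: big1 => b' _; rewrite mxE ha mul0r.
Qed.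

End MixedDiscriminant.

Section DoublyStochastic.
Variables (R : realType) (n : nat).
Implicit Types (A B : 'I_n -> 'M[R[i]]_n) (M N : 'M[R[i]]_n).

Definition psdmx M : Prop :=
  M \is hermsymmx /\ forall x : 'cV[R[i]]_n, 0 <= (x ^t* *m M *m x) 0 0.

Definition doubly_stochastic A : Prop :=
  [/\ forall i, psdmx (A i), forall i, \tr (A i) = 1 & \sum_i A i = 1%:M].

(* tr(MN) is real for hermitian M and N, so taking the real part is only a
   cast to R; the same holds for [mixed_disc] on hermitian tuples below. *)
Definition herm_inner M N : R := complex.Re (\tr (M *m N)).

Definition tuple_dist A B : R :=
  Num.sqrt (\sum_i herm_inner (A i - B i) (A i - B i)).

Definition local_minimizer_mixed_disc A : Prop :=
  doubly_stochastic A /\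
  exists2 eps : R, 0 < eps &
    forall B, doubly_stochastic B -> tuple_dist B A < eps ->
      complex.Re (mixed_disc A) <= complex.Re (mixed_disc B).

End DoublyStochastic.

(* Main.v *)
(* A point of the segment from [A] to another doubly stochastic tuple [B] gives
   the first order condition [sum_i tr ((B_i - A_i) Q_i) >= 0].  Hence on the
   cone of pairs [(X, tau)] with all [X_i] positive semidefinite and
   [tau >= 0], the linear form [sum_i tr (X_i Q_i) - tau sum_i tr (A_i Q_i)] is
   nonnegative as soon as [tr X_i = tau] and [sum_i X_i = tau I].  Lagrange
   multipliers [c_i] and [H] for these finitely many real linear constraints
   exist by eliminating one constraint at a time, and [P_i = Q_i + c_i I + H]
   then satisfies [tr (X P_i) >= 0] for every positive semidefinite [X] and
   [tr (A_i P_i) = 0]. *)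

Require Import Defs.
From mathcomp Require Import all_boot all_order all_fingroup all_algebra.
From mathcomp Require Import complex classical_sets reals ring lra.

Set Implicit Arguments.
Unset Strict Implicit.
Unset Printing Implicit Defensive.

Import Order.TTheory GRing.Theory Num.Theory.
Local Open Scope ring_scope.
Local Open Scope complex_scope.
Local Open Scope sesquilinear_scope.

(** * Lagrange multipliers for finitely many real constraints on a cone *)

Section Multipliers.
Variables (R : realType) (T : Type) (K : T -> Prop).

(** [T] carries no linear structure: only the joint values of [phi] and the [psi j] on [K] have to
    be closed under nonnegative combinations, so that they form a convex cone. *)
Definition conic_for (I : eqType) (phi : T -> R) (psi : I -> T -> R) : Prop :=
  forall x y a b, K x -> K y -> 0 <= a -> 0 <= b ->
    exists z, [/\ K z, phi z = a * phi x + b * phi y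
                & forall j, psi j z = a * psi j x + b * psi j y].

(* This plays the role of Slater's condition: it makes the feasible interval
   for each multiplier bounded on both sides. *)
Definition symmetric_for (I : eqType) (psi : I -> T -> R) : Prop :=
  forall x, K x -> exists2 z, K z & forall j, psi j z = - psi j x.

(** Among points satisfying the constraints in [s], those with [psi j > 0] bound [c] from below by
    [- phi / psi j], and those with [psi j < 0] bound it from above by [phi / - psi j]. Positivity
    at a combination that cancels [psi j] puts every lower bound below every upper bound, and [c] is
    the supremum of the lower bounds. *)
Lemma multiplier_step (I : eqType) (phi : T -> R) (psi : I -> T -> R) j s :
  conic_for phi psi -> symmetric_for psi ->
  (forall x, K x -> (forall k, k \in j :: s -> psi k x = 0) -> 0 <= phi x) ->
  exists c, forall x, K x -> (forall k, k \in s -> psi k x = 0) ->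
    0 <= phi x + c * psi j x.
Proof.
move=> conK symK pos.
pose E : set R := fun r => exists x,
  [/\ K x, forall k, k \in s -> psi k x = 0, 0 < psi j x & r = - phi x / psi j x].
have upper y : K y -> (forall k, k \in s -> psi k y = 0) -> psi j y < 0 ->
    ubound E (phi y / - psi j y).
  move=> Ky y0 yneg r [x [Kx x0 xpos ->]].
  (* The weights are chosen so that [psi j] vanishes at [z], which makes [pos] applicable. *)
  have [z [Kz phz psz]] := conK x y (- psi j y) (psi j x) Kx Ky ltac:(lra) ltac:(lra).
  have := pos z Kz; rewrite phz => h.
  rewrite ler_pdivrMr // mulrAC ler_pdivlMr; last by lra.
  suff : 0 <= - psi j y * phi x + psi j x * phi y by nra.
  apply: h => k; rewrite inE psz => /orP[/eqP->|ks]; first by ring.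
  by rewrite (x0 k) // (y0 k) //; ring.
(* The point symmetric to [x] shows that [E] is nonempty when [psi j x < 0], and that [E] is bounded
   above when [psi j x > 0]. *)
exists (sup E) => x Kx x0.
have [xneg|xpos|xz] := ltgtP (psi j x) 0.
- have [y Ky yx] := symK x Kx.
  have E0 : (E !=set0)%classic.
    by exists (- phi y / psi j y), y; split=> // [k ks|]; rewrite yx ?oppr_gt0 ?oppr_lt0 // x0 ?oppr0.
  have := ge_sup E0 (upper x Kx x0 xneg).
  by rewrite ler_pdivlMr; [nra|lra].
- have [y Ky yx] := symK x Kx.
  have Ex : E (- phi x / psi j x) by exists x.
  have Eb : has_sup E.
    split; first by exists (- phi x / psi j x).
    by exists (phi y / - psi j y); apply: upper => // [k ks|]; rewrite yx ?oppr_gt0 ?oppr_lt0 // x0 ?oppr0.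
  have := sup_upper_bound Eb Ex.
  by rewrite ler_pdivrMr //; nra.
- rewrite xz mulr0 addr0; apply: pos => // k; rewrite inE => /orP[/eqP->//|]; exact: x0.
Qed.

Lemma multiplier_seq (I : eqType) (psi : I -> T -> R) s (phi : T -> R) :
  uniq s -> conic_for phi psi -> symmetric_for psi ->
  (forall x, K x -> (forall k, k \in s -> psi k x = 0) -> 0 <= phi x) ->
  exists c : I -> R, forall x, K x -> 0 <= phi x + \sum_(k <- s) c k * psi k x.
Proof.
elim: s phi => [|j s IH] phi /=.
  move=> _ _ _ pos; exists (fun=> 0) => x Kx.
  by rewrite big_nil addr0; apply: pos.
move=> /andP[js us] conK symK pos.
have [d hd] := multiplier_step conK symK pos.
(* The constraint [j] is absorbed into the objective, which still combines conically with the [psi]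
   values. *)
have [|c hc] := IH (fun x => phi x + d * psi j x) us _ symK hd.
  move=> x y a b Kx Ky a0 b0.
  have [z [Kz phz psz]] := conK x y a b Kx Ky a0 b0.
  by exists z; split=> //; rewrite phz psz; ring.
exists (fun k => if k == j then d else c k) => x Kx.
rewrite big_cons eqxx addrA; have := hc x Kx.
congr (0 <= _ + _); apply: eq_big_seq => k ks.
by case: eqP => // kj; rewrite -kj ks in js.
Qed.

Lemma multiplier_rule (I : finType) (phi : T -> R) (psi : I -> T -> R) :
  conic_for phi psi -> symmetric_for psi ->
  (forall x, K x -> (forall k, psi k x = 0) -> 0 <= phi x) ->
  exists c : I -> R, forall x, K x -> 0 <= phi x + \sum_k c k * psi k x.
Proof.
move=> conK symK pos; rewrite /index_enum.
apply: multiplier_seq => //; first by rewrite -enumT enum_uniq.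
by move=> x Kx h; apply: pos => // k; apply: h; rewrite -enumT mem_enum.
Qed.

End Multipliers.

(** * First order expansion of the mixed discriminant along a line *)

Section Jet.
Variable C : comNzRingType.

(** A first order Taylor expansion at 0. The remainder is required to be polynomial, so sums and
    products are handled by algebra alone, and it can later be bounded on [[0, 1]]. *)
Definition jet (f : C -> C) (a b : C) : Prop :=
  exists p : {poly C}, forall t, f t = a + b * t + t ^+ 2 * p.[t].

Lemma jet_ext f g a b a' b' :
  jet f a b -> f =1 g -> a = a' -> b = b' -> jet g a' b'.
Proof. by move=> [p hp] fg <- <-; exists p => t; rewrite -fg. Qed.

Lemma jet_affine a b : jet (fun t => a + t * b) a b.
Proof. by exists 0 => t; rewrite horner0; ring. Qed.

Lemma jetM f g a b a' b' :
  jet f a b -> jet g a' b' -> jet (fun t => f t * g t) (a * a') (b * a' + a * b').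
Proof.
move=> [p hp] [q hq].
exists ((b * b')%:P + a%:P * q + a'%:P * p + 'X * (b%:P * q + b'%:P * p)
        + 'X ^+ 2 * (p * q)) => t.
by rewrite hp hq !hornerE /=; ring.
Qed.

Lemma jet_sum (I : Type) (r : seq I) (P : pred I) f a b :
  (forall i, P i -> jet (f i) (a i) (b i)) ->
  jet (fun t => \sum_(i <- r | P i) f i t)
    (\sum_(i <- r | P i) a i) (\sum_(i <- r | P i) b i).
Proof.
move=> h; elim: r => [|i r [p hp]].
  by exists 0 => t; rewrite !big_nil horner0; ring.
case Pi: (P i); last by exists p => t; rewrite !big_cons Pi hp.
have [q hq] := h i Pi; exists (q + p) => t.
by rewrite !big_cons Pi hp hq hornerD; ring.
Qed.

Lemma jet_prod (I : eqType) (r : seq I) (a b : I -> C) : uniq r ->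
  jet (fun t => \prod_(i <- r) (a i + t * b i)) (\prod_(i <- r) a i)
    (\sum_(i <- r) \prod_(j <- r) (if j == i then b j else a j)).
Proof.
elim: r => [_|i r IH /= /andP[ir ur]].
  by exists 0 => t; rewrite !big_nil horner0; ring.
apply: (jet_ext (jetM (jet_affine (a i) (b i)) (IH ur))) => [t||].
- by rewrite big_cons.
- by rewrite big_cons.
- rewrite !big_cons eqxx; congr (_ * _ + _).
    by apply: eq_big_seq => j jr; case: eqP => // ji; rewrite -ji jr in ir.
  rewrite mulr_sumr; apply: eq_big_seq => k kr; rewrite big_cons.
  by case: eqP => // ik; rewrite ik kr in ir.
Qed.

(** The product rule on each term of the expansion perturbs one factor [k] at a time. As [f] is
    injective, this is the same as perturbing one matrix [i = f k] at a time. *)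
Lemma jet_mixed_disc n (A E : 'I_n -> 'M[C]_n) :
  jet (fun t => mixed_disc (fun i => A i + t *: E i)) (mixed_disc A)
    (\sum_i mixed_disc (replace A i (E i))).
Proof.
have step (s : 'S_n) (f : {ffun 'I_n -> 'I_n}) : injectiveb f ->
   jet (fun t => (-1) ^+ s * \prod_k (A (f k) + t *: E (f k)) k (s k))
     ((-1) ^+ s * \prod_k A (f k) k (s k))
     (\sum_i (-1) ^+ s * \prod_k replace A i (E i) (f k) k (s k)).
  move=> /injectiveP inj_f.
  apply: (jet_ext (jetM (jet_affine ((-1) ^+ s) 0)
    (jet_prod (fun k => A (f k) k (s k)) (fun k => E (f k) k (s k))
      (index_enum_uniq 'I_n)))) => [t||] //.
    by rewrite mulr0 addr0; congr (_ * _); apply: eq_bigr => k _; rewrite !mxE.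
  rewrite mul0r add0r mulr_sumr [RHS](reindex_inj inj_f).
  apply: eq_bigr => i _; congr (_ * _); apply: eq_bigr => k _.
  by rewrite /replace (inj_eq inj_f); case: eqP => [->|].
have h : jet _ _ _ := jet_sum (index_enum _) (fun (s : 'S_n) (_ : true) =>
  jet_sum (index_enum _) (fun f => @step s f)).
apply: (jet_ext h) => [t||].
- by rewrite mixed_discE.
- by rewrite mixed_discE.
- under [RHS]eq_bigr => i _ do rewrite mixed_discE.
  rewrite [RHS]exchange_big; apply: eq_bigr => s _.
  by rewrite [RHS]exchange_big.
Qed.

End Jet.

(** * Complex scalars, adjoints and positive semidefinite matrices *)

Section ComplexMatrices.
Variable R : realType.
Implicit Types (t : R) (z : R[i]).

Lemma ReD z1 z2 : complex.Re (z1 + z2) = complex.Re z1 + complex.Re z2.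
Proof. by case: z1 z2 => [? ?] [? ?]. Qed.

Lemma ReB z1 z2 : complex.Re (z1 - z2) = complex.Re z1 - complex.Re z2.
Proof. by case: z1 z2 => [? ?] [? ?]. Qed.

Lemma Re_sum (I : Type) (r : seq I) (P : pred I) (F : I -> R[i]) :
  complex.Re (\sum_(i <- r | P i) F i) = \sum_(i <- r | P i) complex.Re (F i).
Proof. exact: (big_morph _ ReD). Qed.

Lemma ReZ t z : complex.Re (t%:C * z) = t * complex.Re z.
Proof. by case: z => a b /=; rewrite mul0r subr0. Qed.

Lemma ImZ t z : complex.Im (t%:C * z) = t * complex.Im z.
Proof. by case: z => a b /=; rewrite mul0r addr0. Qed.

Lemma ImD z1 z2 : complex.Im (z1 + z2) = complex.Im z1 + complex.Im z2.
Proof. by case: z1 z2 => [? ?] [? ?]. Qed.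

Lemma Re_conjc z : complex.Re (Num.conj z) = complex.Re z.
Proof. by case: z. Qed.

Lemma Re_sqr_norm_eq0 z : complex.Re (`|z| ^+ 2) = 0 -> z = 0.
Proof.
move=> h; apply/eqP; rewrite -normr_eq0 -sqrf_eq0.
by rewrite -(RRe_real (ger0_real (exprn_ge0 2 (normr_ge0 z)))) h.
Qed.

Lemma conj_real t : Num.conj t%:C = t%:C :> R[i].
Proof. exact: conjc_real. Qed.

Lemma conj_fix_Im z : Num.conj z = z -> complex.Im z = 0.
Proof. by case: z => a b [] /= h; lra. Qed.

(** Induction on the Horner form: a factor [t] in [[0, 1]] does not increase a bound, and a constant
    [c] adds at most the modulus of its real part. *)
Lemma Re_poly_bound (p : {poly R[i]}) :
  exists2 M, 0 <= M & forall t, 0 <= t <= 1 -> complex.Re p.[t%:C] <= M.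
Proof.
suff [M hM] : exists M, forall t, 0 <= t <= 1 -> `|complex.Re p.[t%:C]| <= M.
  exists M => [|t t01]; last by apply: le_trans (hM t t01); rewrite ler_norm.
  by apply: le_trans (normr_ge0 _) (hM 0 _); rewrite lexx ler01.
elim/poly_ind: p => [|p c [M hM]].
  by exists 0 => t _; rewrite horner0 normr0.
exists (M + `|complex.Re c|) => t t01.
rewrite hornerMXaddC mulrC ReD ReZ; apply: le_trans (ler_normD _ _) _.
rewrite lerD2r normrM; apply: le_trans (hM t t01).
by rewrite ler_piMl // ger0_norm; case/andP: t01.
Qed.

Section Adjoint.
Variables m n : nat.
Implicit Types M N : 'M[R[i]]_(m, n).

Lemma adjmxE M a b : M ^t* a b = Num.conj (M b a).
Proof. by rewrite !mxE. Qed.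

Lemma adjmxK M : (M ^t*) ^t* = M.
Proof. by apply/matrixP=> a b; rewrite !mxE conjCK. Qed.

Lemma adjmxD M N : (M + N) ^t* = M ^t* + N ^t*.
Proof. by rewrite linearD map_mxD. Qed.

Lemma adjmxN M : (- M) ^t* = - M ^t*.
Proof. by rewrite linearN map_mxN. Qed.

Lemma adjmxZ t M : (t%:C *: M) ^t* = t%:C *: M ^t*.
Proof. by rewrite linearZ map_mxZ /= conj_real. Qed.

End Adjoint.

Lemma adjmxM m n p (M : 'M[R[i]]_(m, n)) (N : 'M[R[i]]_(n, p)) :
  (M *m N) ^t* = N ^t* *m M ^t*.
Proof. by rewrite trmx_mul map_mxM. Qed.

Section Hermitian.
Variable n : nat.
Implicit Types M N X : 'M[R[i]]_n.

Lemma adjmx_scalar t : (t%:C%:M : 'M[R[i]]_n) ^t* = t%:C%:M.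
Proof. by rewrite tr_scalar_mx map_scalar_mx /= conj_real. Qed.

Lemma hermP M : reflect (M ^t* = M) (M \is hermsymmx).
Proof.
by apply: (iffP (is_hermitianmxP _ _ _)); rewrite expr0 scale1r => /esym.
Qed.

Lemma trace_adjmx M : \tr (M ^t*) = Num.conj (\tr M).
Proof. by rewrite /mxtrace rmorph_sum; apply: eq_bigr => a _; rewrite adjmxE. Qed.

Lemma trace_mulC_conj M N : \tr (M ^t* *m N ^t*) = Num.conj (\tr (M *m N)).
Proof. by rewrite -trace_adjmx adjmxM mxtrace_mulC. Qed.

Lemma trace_pairing_inj M N : (forall X, \tr (X *m M) = \tr (X *m N)) -> M = N.
Proof.
move=> h; apply/matrixP=> a b; have := h (delta_mx b a).
have e (L : 'M[R[i]]_n) : \tr (delta_mx b a *m L) = L a b.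
  rewrite /mxtrace (bigD1 b) //= big1 => [|k kb]; last first.
    rewrite mxE big1 // => l _; by rewrite mxE (negbTE kb) mul0r.
  rewrite mxE addr0 (bigD1 a) //= mxE !eqxx mul1r big1 ?addr0 // => l la.
  by rewrite mxE (negbTE la) andbF mul0r.
by rewrite !e.
Qed.

Lemma psdmx_herm M : psdmx M -> M ^t* = M.
Proof. by case=> /hermP. Qed.

(** In [R[i]], [0 <= z] also demands a zero imaginary part. For hermitian [M] the quadratic form
    equals its own conjugate, so only the real part needs checking. *)
Lemma psdmxI M : M ^t* = M ->
  (forall x : 'cV_n, 0 <= complex.Re ((x ^t* *m M *m x) 0 0)) -> psdmx M.
Proof.
move=> hM h; split; first exact/hermP.
move=> x; rewrite lecE h andbT; apply/eqP/conj_fix_Im.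
by rewrite -adjmxE !adjmxM adjmxK hM mulmxA.
Qed.

Lemma psdmx_Re M (x : 'cV_n) : psdmx M ->
  0 <= complex.Re ((x ^t* *m M *m x) 0 0).
Proof. by case=> _ /(_ x); rewrite lecE => /andP[]. Qed.

Lemma psdmxD M N : psdmx M -> psdmx N -> psdmx (M + N).
Proof.
move=> hM hN; apply: psdmxI => [|x]; first by rewrite adjmxD !psdmx_herm.
by rewrite mulmxDr mulmxDl mxE ReD addr_ge0 // psdmx_Re.
Qed.

Lemma psdmxZ t M : 0 <= t -> psdmx M -> psdmx (t%:C *: M).
Proof.
move=> t0 hM; apply: psdmxI => [|x]; first by rewrite adjmxZ psdmx_herm.
by rewrite -scalemxAr -scalemxAl mxE ReZ mulr_ge0 // psdmx_Re.
Qed.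

Lemma psdmx0 : psdmx (0 : 'M[R[i]]_n).
Proof.
apply: psdmxI => [|x]; first by rewrite trmx0 map_mx0.
by rewrite mulmx0 mul0mx mxE.
Qed.

Lemma psdmx_congr (T M : 'M[R[i]]_n) : psdmx M -> psdmx (T *m M *m T ^t*).
Proof.
move=> hM; apply: psdmxI => [|x].
  by rewrite !adjmxM adjmxK psdmx_herm // mulmxA.
have -> : x ^t* *m (T *m M *m T ^t*) *m x = (T ^t* *m x) ^t* *m M *m (T ^t* *m x).
  by rewrite adjmxM adjmxK !mulmxA.
exact: psdmx_Re.
Qed.

Lemma psdmx_outer (x : 'cV[R[i]]_n) : psdmx (x *m x ^t*).
Proof.
apply: psdmxI => [|y]; first by rewrite adjmxM adjmxK.
have -> : y ^t* *m (x *m x ^t*) *m y = (x ^t* *m y) ^t* *m (x ^t* *m y).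
  by rewrite adjmxM adjmxK !mulmxA.
rewrite mxE big_ord1 adjmxE mulrC -normCK.
by have := exprn_ge0 2 (normr_ge0 ((x ^t* *m y) 0 0)); rewrite lecE => /andP[].
Qed.

(** The sum [S] of the moduli of the entries bounds the quadratic form of [M] by [S] times the
    squared norm of [x]. *)
Lemma psdmx_scalar_sub M : M ^t* = M ->
  exists2 c0, 0 <= c0 & forall c, c0 <= c -> psdmx (c%:C%:M - M).
Proof.
move=> hM; pose S := \sum_a \sum_b `|M a b|.
have S0 : 0 <= S by apply: sumr_ge0 => a _; apply: sumr_ge0.
have SE : S = (complex.Re S)%:C by rewrite RRe_real // ger0_real.
exists (complex.Re S) => [|c Sc]; first by move: S0; rewrite lecE => /andP[].
apply: psdmxI => [|x]; first by rewrite adjmxD adjmxN hM adjmx_scalar.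
pose N2 := \sum_a `|x a 0| ^+ 2.
have N20 : 0 <= N2 by apply: sumr_ge0 => a _; apply: exprn_ge0.
suff h : `|(x ^t* *m M *m x) 0 0| <= S * N2.
  have hN : (x ^t* *m (c%:C%:M) *m x) 0 0 = c%:C * N2.
    rewrite mul_mx_scalar -scalemxAl mxE; congr (_ * _).
    rewrite mxE; apply: eq_bigr => a _.
    by rewrite adjmxE mulrC normCK.
  rewrite mulmxBr mulmxBl; set q := x ^t* *m M *m x in h *.
  rewrite [(_ - q) 0 0]mxE [(- q) 0 0]mxE hN ReB ReZ subr_ge0.
  have := le_trans (normc_ge_Re _) h; rewrite SE lecE ReZ /= => /andP[_ hq].
  have N2r : 0 <= complex.Re N2 by move: N20; rewrite lecE => /andP[].
  by apply: le_trans (ler_wpM2r N2r Sc); apply: le_trans hq; rewrite ler_norm.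
have xx a b : `|x a 0| * `|x b 0| <= N2.
  have le1 k : `|x k 0| ^+ 2 <= N2.
    by rewrite /N2 (bigD1 k) //= lerDl; apply: sumr_ge0 => l _; apply: exprn_ge0.
  have [hab|hab] := real_leP (normr_real (x a 0)) (normr_real (x b 0)).
    by apply: le_trans (le1 b); rewrite expr2 ler_wpM2r.
  by apply: le_trans (le1 a); rewrite expr2 ler_wpM2l // ltW.
rewrite mxE; apply: le_trans (ler_norm_sum _ _ _) _.
rewrite /S exchange_big mulr_suml; apply: ler_sum => b _.
rewrite mxE normrM mulr_suml.
apply: le_trans (ler_wpM2r (normr_ge0 _) (ler_norm_sum _ _ _)) _.
rewrite mulr_suml; apply: ler_sum => a _.
rewrite normrM adjmxE norm_conjC mulrC mulrA [_ * `|M a b|]mulrC.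
by rewrite ler_wpM2l // mulrC.
Qed.

(* Perturbing [A] to [(1 - e PA) A (1 - e PA)^*] lowers [tr (A P)] by
   [2 e |AP|^2] to first order. *)
Lemma psd_annihilates (A P : 'M[R[i]]_n) : psdmx A -> P ^t* = P ->
  (forall X, psdmx X -> 0 <= complex.Re (\tr (X *m P))) ->
  complex.Re (\tr (A *m P)) = 0 -> A *m P = 0.
Proof.
move=> psdA hP pos zero; have hA := psdmx_herm psdA.
pose F := A *m P; pose T := P *m A.
have TE : T ^t* = F by rewrite adjmxM hA hP.
pose f := complex.Re (\tr (T *m F)).
pose g := complex.Re (\tr (T *m A *m F *m P)).
have expand e : complex.Re (\tr ((1%:M - e%:C *: T) *m A *m
    (1%:M - e%:C *: T) ^t* *m P)) = - (2 * e * f) + e ^+ 2 * g.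
  rewrite adjmxD adjmxN adjmxZ TE -[1%:M]/((1 : R)%:C%:M) adjmx_scalar /=.
  rewrite -[(1 : R)%:C%:M]/(1%:M) !mulmxBl !mulmxBr !mul1mx !mulmx1 !mulmxBl.
  rewrite -!scalemxAl -!scalemxAr -!scalemxAl !linearB /= !linearZ /=.
  have TF : T *m A *m P = T *m F by rewrite -mulmxA.
  have AFP : \tr (A *m F *m P) = \tr (T *m F).
    by rewrite mxtrace_mulC mulmxA.
  by rewrite !ReZ zero TF AFP /f /g; ring.
(* [f] is the squared Frobenius norm of [F = A *m P], so [f = 0] forces [F = 0]. *)
have fE : f = \sum_a \sum_b complex.Re (`|F a b| ^+ 2).
  rewrite /f mxtrace_mulC /mxtrace Re_sum; apply: eq_bigr => a _.
  rewrite mxE Re_sum; apply: eq_bigr => b _.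
  by rewrite -[T]adjmxK TE adjmxE normCK.
have sq0 a b : 0 <= complex.Re (`|F a b| ^+ 2).
  by have := exprn_ge0 2 (normr_ge0 (F a b)); rewrite lecE => /andP[].
have f0 : f = 0.
  apply/eqP; rewrite eq_le andbC fE; apply/andP; split.
    by apply: sumr_ge0 => a _; apply: sumr_ge0.
  rewrite -fE leNgt; apply/negP => fpos.
  (* This choice gives [e * g < f], so the linear term of [expand] outweighs the quadratic one and
     the trace becomes negative. *)
  pose e := f / (1 + `|g|).
  have g1 : 0 < 1 + `|g| by have := normr_ge0 g; lra.
  have epos : 0 < e by rewrite divr_gt0.
  have := pos _ (psdmx_congr (1%:M - e%:C *: T) psdA).
  rewrite expand; apply/negP; rewrite -ltNge.
  have eg : e * (1 + `|g|) = f by rewrite /e divfK // gt_eqF.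
  have := ler_norm g; nra.
apply/matrixP=> a b; rewrite -/F [RHS]mxE.
apply: Re_sqr_norm_eq0; apply/eqP.
move/eqP: f0; rewrite fE psumr_eq0 => [|k _]; last exact: sumr_ge0.
move=> /allP /(_ a (mem_index_enum _)); rewrite psumr_eq0 => [|k _]; last exact: sq0.
by move=> /allP /(_ b (mem_index_enum _)).
Qed.

End Hermitian.
End ComplexMatrices.

(** * Hermitian tuples and the first order condition at a local minimizer *)

Section MixedDiscriminantHermitian.
Variables (R : realType) (n : nat).
Implicit Types (A B X : 'I_n -> 'M[R[i]]_n).

(** Taking adjoints swaps rows and columns, which replaces [s] by its inverse, of the same sign, and
    [f] by its composition with [s]; the terms then match up to conjugation. *)
Lemma mixed_disc_adjmx A :
  mixed_disc (fun i => (A i) ^t*) = Num.conj (mixed_disc A).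
Proof.
rewrite !mixed_discE rmorph_sum (reindex_inj invg_inj) /=.
apply: eq_bigr => s _; rewrite rmorph_sum.
pose h (f : {ffun 'I_n -> 'I_n}) : {ffun 'I_n -> 'I_n} := [ffun k => f (s k)].
have h_bij : bijective h.
  exists (fun f : {ffun 'I_n -> 'I_n} => [ffun k => f ((s^-1)%g k)]) => f; apply/ffunP=> k.
    by rewrite !ffunE permKV.
  by rewrite !ffunE permK.
rewrite [RHS](reindex h) /=; last exact: onW_bij.
rewrite [RHS](eq_bigl (fun f : {ffun 'I_n -> 'I_n} => injectiveb f)); last first.
  move=> f; apply/injectiveP/injectiveP => inj_f x y.
    move=> fxy; have := inj_f ((s^-1)%g x) ((s^-1)%g y).
    by rewrite !ffunE !permKV => /(_ fxy) /perm_inj.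
  by rewrite !ffunE => /inj_f /perm_inj.
apply: eq_bigr => f _; rewrite odd_permV rmorphM rmorphXn rmorphN1 rmorph_prod.
congr (_ * _); rewrite (reindex_inj (@perm_inj _ s)) /=.
by apply: eq_bigr => k _; rewrite adjmxE ffunE permK.
Qed.

(** Replacing [X] by its adjoint conjugates the mixed discriminant, so the adjoint of [Q] represents
    the same linear form as [Q]. *)
Lemma mixed_grad_herm A i Q : (forall j, (A j) ^t* = A j) ->
  is_mixed_grad A i Q -> Q ^t* = Q.
Proof.
move=> hA hQ; apply: trace_pairing_inj => X.
rewrite -[X]adjmxK trace_mulC_conj -hQ -mixed_disc_adjmx -hQ.
rewrite !mixed_discE; apply: eq_bigr => s _; apply: eq_bigr => f _.
congr (_ * _); apply: eq_bigr => k _; rewrite /replace.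
by case: eqP; rewrite ?hA.
Qed.

Lemma doubly_stochastic_segment A B t :
  doubly_stochastic A -> doubly_stochastic B -> 0 <= t <= 1 ->
  doubly_stochastic (fun i => A i + t%:C *: (B i - A i)).
Proof.
move=> [pA tA sA] [pB tB sB] /andP[t0 t1]; split=> [i|i|].
- have -> : A i + t%:C *: (B i - A i) = (1 - t)%:C *: A i + t%:C *: B i.
    by rewrite rmorphB rmorph1 scalerBl scale1r scalerBr addrA addrAC.
  by apply: psdmxD; apply: psdmxZ => //; rewrite subr_ge0.
- by rewrite linearD linearZ linearB /= tA tB subrr mulr0 addr0.
- by rewrite big_split /= -scaler_sumr sumrB sA sB subrr scaler0 addr0.
Qed.

Lemma tuple_dist_segment A B t : 0 <= t ->
  tuple_dist (fun i => A i + t%:C *: (B i - A i)) A = t * tuple_dist B A.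
Proof.
move=> t0; rewrite /tuple_dist -[t in RHS]ger0_norm // -sqrtr_sqr -sqrtrM ?sqr_ge0 //.
congr Num.sqrt; rewrite mulr_sumr; apply: eq_bigr => i _.
rewrite /herm_inner addrC addKr -scalemxAl -scalemxAr !linearZ /=.
by rewrite !ReZ mulrA expr2.
Qed.

Lemma local_minimizer_first_order A B (Q : 'I_n -> 'M[R[i]]_n) :
  local_minimizer_mixed_disc A -> (forall i, is_mixed_grad A i (Q i)) ->
  doubly_stochastic B ->
  0 <= complex.Re (\sum_i \tr ((B i - A i) *m Q i)).
Proof.
move=> [dsA [eps eps0 Amin]] QE dsB.
have [p hp] := jet_mixed_disc A (fun i => B i - A i).
under eq_bigr => i _ do rewrite -QE.
set b := \sum_i _ in hp *; rewrite leNgt; apply/negP => bneg.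
have [M M0 hM] := Re_poly_bound p.
set d := tuple_dist B A; have d0 : 0 <= d by exact: sqrtr_ge0.
(* The three bounds keep the point on the segment, bring it within [eps] of [A], and make the
   negative linear term beat the remainder. Each [+ 1] keeps a denominator positive and makes the
   resulting inequality strict. *)
pose t := Num.min 1 (Num.min (eps / (d + 1)) (- complex.Re b / (M + 1))).
have t0 : 0 < t by rewrite !lt_min ltr01 !divr_gt0 //; lra.
have t1 : t <= 1 by rewrite ge_min lexx.
have td : t * (d + 1) <= eps.
  by rewrite -ler_pdivlMr ?ge_min ?lexx ?orbT //; lra.
have tM : t * (M + 1) <= - complex.Re b.
  by rewrite -ler_pdivlMr ?ge_min ?lexx ?orbT //; lra.
have t01 : 0 <= t <= 1 by rewrite ltW.
have : complex.Re (mixed_disc A) <=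
    complex.Re (mixed_disc A + b * t%:C + t%:C ^+ 2 * p.[t%:C]).
  rewrite -hp; apply: Amin; first exact: doubly_stochastic_segment.
  by rewrite tuple_dist_segment ?ltW // -/d; nra.
rewrite !ReD -rmorphXn ReZ [b * _]mulrC ReZ.
by have := hM t t01; nra.
Qed.

End MixedDiscriminantHermitian.

(** * Multipliers for the constraints that define doubly stochastic tuples *)

Section Lagrange.
Variables (R : realType) (n : nat).
Implicit Types (A Q : 'I_n.+1 -> 'M[R[i]]_n.+1) (x y : ('I_n.+1 -> 'M[R[i]]_n.+1) * R).

(* A point [(X, tau)] of the cone satisfies all constraints exactly when [X]
   is [tau] times a doubly stochastic tuple; since [Re + Im] vanishes on both
   [z] and its conjugate only if [z = 0], one real constraint per matrix entry
   suffices for the hermitian matrix [ds_defect]. *)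
Definition psd_cone x : Prop := (forall i, psdmx (x.1 i)) /\ 0 <= x.2.

Definition ds_defect x : 'M[R[i]]_n.+1 := \sum_i x.1 i - (x.2)%:C%:M.

Definition ds_constraint (k : 'I_n.+1 + 'I_n.+1 * 'I_n.+1) x : R :=
  match k with
  | inl i => complex.Re (\tr (x.1 i)) - x.2
  | inr (a, b) => complex.Re (ds_defect x a b) + complex.Im (ds_defect x a b)
  end.

(** The homogenized first order condition: at [(B, 1)] it is the real part of the sum of the traces
    of [(B i - A i) *m Q i]. *)
Definition excess A Q x : R :=
  complex.Re (\sum_i \tr (x.1 i *m Q i)) -
  x.2 * complex.Re (\sum_i \tr (A i *m Q i)).

Definition comb (a b : R) x y : ('I_n.+1 -> 'M[R[i]]_n.+1) * R :=
  (fun i => a%:C *: x.1 i + b%:C *: y.1 i, a * x.2 + b * y.2).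

Lemma ds_defect_comb a b x y :
  ds_defect (comb a b x y) = a%:C *: ds_defect x + b%:C *: ds_defect y.
Proof.
rewrite /ds_defect /= big_split /= -!scaler_sumr rmorphD !rmorphM /=.
by rewrite !scalerBr !scale_scalar_mx raddfD opprD addrACA.
Qed.

Lemma ds_constraint_comb a b x y k :
  ds_constraint k (comb a b x y) = a * ds_constraint k x + b * ds_constraint k y.
Proof.
case: k => [i|[p q]] /=.
  by rewrite linearD !linearZ /= ReD !ReZ; ring.
rewrite ds_defect_comb !mxE ReD ImD !ReZ !ImZ; ring.
Qed.

Lemma excess_comb A Q a b x y :
  excess A Q (comb a b x y) = a * excess A Q x + b * excess A Q y.
Proof.
rewrite /excess /=.
under eq_bigr => i _ do rewrite mulmxDl -!scalemxAl linearD !linearZ /=.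
rewrite big_split /= -!mulr_sumr ReD !ReZ; ring.
Qed.

Lemma psd_cone_conic A Q : conic_for psd_cone (excess A Q) ds_constraint.
Proof.
move=> x y a b [psdx x0] [psdy y0] a0 b0; exists (comb a b x y); split=> [||k].
- split=> [i|]; last by rewrite addr_ge0 ?mulr_ge0.
  by apply: psdmxD; apply: psdmxZ.
- exact: excess_comb.
- exact: ds_constraint_comb.
Qed.

(** The pair made of the constant tuple [c I] and [tau = c * n.+1] satisfies every constraint, since
    the matrices have size [n.+1]. Subtracting [x] from it negates the constraints, and a large [c]
    keeps the difference in the cone. *)
Lemma psd_cone_symmetric : symmetric_for psd_cone ds_constraint.
Proof.
move=> x [psdx x0].
have [c [cx cX]] : exists c : R, x.2 <= c /\ forall i, psdmx (c%:C%:M - x.1 i).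
  have /fin_all_exists[c hc] (i : 'I_n.+1) : exists c : R, 0 <= c /\
      forall d, c <= d -> psdmx (d%:C%:M - x.1 i).
    by have [c] := psdmx_scalar_sub (psdmx_herm (psdx i)); exists c.
  exists (x.2 + \sum_i c i); split=> [|i].
    by rewrite lerDl sumr_ge0 // => i _; case: (hc i).
  apply: (proj2 (hc i)); rewrite (bigD1 i) //= addrCA lerDl addr_ge0 //.
  by rewrite sumr_ge0 // => j _; case: (hc j).
exists (fun i => c%:C%:M - x.1 i, c * n.+1%:R - x.2).
  split=> //=; rewrite subr_ge0; apply: (le_trans cx).
  by rewrite ler_peMr ?ler1n // (le_trans x0 cx).
have cn : c%:C *+ n.+1 = (c * n.+1%:R)%:C by rewrite mulr_natr rmorphMn.
move=> [i|[p q]] /=.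
  by rewrite linearB /= mxtrace_scalar ReB cn /=; ring.
have -> : ds_defect (fun i => c%:C%:M - x.1 i, c * n.+1%:R - x.2) = - ds_defect x.
  rewrite /ds_defect /= sumrB sumr_const card_ord -raddfMn cn rmorphB raddfB /=.
  by rewrite !opprB addrC addrA subrK.
by rewrite mxE; case: (ds_defect x p q) => u v /=; ring.
Qed.

Lemma ds_defect_herm x : psd_cone x -> (ds_defect x) ^t* = ds_defect x.
Proof.
move=> [psdx _]; rewrite adjmxD adjmxN adjmx_scalar; congr (_ - _).
rewrite (big_morph (fun M => M ^t*) (@adjmxD R _ _) (id1 := 0) (id2 := 0)).
  by apply: eq_bigr => i _; exact: psdmx_herm.
by rewrite trmx0 map_mx0.
Qed.

Lemma ds_constraint_eq0 x : psd_cone x -> (forall k, ds_constraint k x = 0) ->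
  (forall i, \tr (x.1 i) = (x.2)%:C) /\ \sum_i x.1 i = (x.2)%:C%:M.
Proof.
move=> Kx h; have [psdx _] := Kx; split=> [i|].
  have := h (inl i) => /= hi.
  have := conj_fix_Im (z := \tr (x.1 i)).
  rewrite -trace_adjmx psdmx_herm // => /(_ erefl).
  by move: hi; case: (\tr (x.1 i)) => u v /= hu ->; congr (_ +i* _); lra.
apply/eqP; rewrite -subr_eq0; apply/eqP.
have herm := ds_defect_herm Kx.
apply/matrixP=> a b; rewrite -/(ds_defect x) [RHS]mxE.
have := h (inr (a, b)); have := h (inr (b, a)); rewrite /= -{1 2}herm adjmxE.
by case: (ds_defect x a b) => u v /= h1 h2; congr (_ +i* _); lra.
Qed.

Lemma excess_ge0 A Q x :
  local_minimizer_mixed_disc A -> (forall i, is_mixed_grad A i (Q i)) ->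
  psd_cone x -> (forall k, ds_constraint k x = 0) -> 0 <= excess A Q x.
Proof.
move=> Amin QE Kx /(ds_constraint_eq0 Kx) [trx sumx].
have [[psdA trA sumA] _] := Amin; have [psdx x0] := Kx.
(* Adding [A] before normalizing makes the total trace factor [1 + x.2], which is nonzero even when
   [x.2 = 0]; moreover [B i - A i] is then [r] times [x.1 i - x.2 A i]. *)
pose r : R := (1 + x.2)^-1.
have d0 : 0 < 1 + x.2 by rewrite ltr_pwDl.
have r0 : 0 < r by rewrite invr_gt0.
have rE : r%:C * (1 + (x.2)%:C) = 1.
  by rewrite -(rmorph1 (real_complex R)) -rmorphD -rmorphM mulVf // gt_eqF.
pose B i := r%:C *: (A i + x.1 i).
have dsB : doubly_stochastic B.
  split=> [i|i|].
  - by apply: psdmxZ; [exact: ltW | exact: psdmxD].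
  - by rewrite linearZ linearD /= trA trx.
  - rewrite -scaler_sumr big_split /= sumA sumx -raddfD /=.
    by rewrite scale_scalar_mx rE.
have := local_minimizer_first_order Amin QE dsB.
suff -> : complex.Re (\sum_i \tr ((B i - A i) *m Q i)) = r * excess A Q x.
  by rewrite pmulr_rge0.
rewrite /excess -ReZ -ReB -ReZ mulr_sumr -sumrB mulr_sumr; congr complex.Re.
apply: eq_bigr => i _.
have -> : B i - A i = r%:C *: (x.1 i - (x.2)%:C *: A i).
  rewrite /B -[X in _ - X]scale1r -rE -scalerA -scalerBr scalerDl scale1r.
  by rewrite opprD addrACA subrr add0r.
by rewrite -scalemxAl mulmxBl -scalemxAl linearZ linearB linearZ.
Qed.

Lemma lagrange_multipliers A Q :
  local_minimizer_mixed_disc A -> (forall i, is_mixed_grad A i (Q i)) ->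
  exists (H : 'M[R[i]]_n.+1) (c : 'I_n.+1 -> R),
    let P i := Q i + (c i)%:C%:M + H in
    H ^t* = H /\ forall x, psd_cone x ->
      x.2 * complex.Re (\sum_i \tr (A i *m P i)) <=
      complex.Re (\sum_i \tr (x.1 i *m P i)).
Proof.
move=> Amin QE.
have [c hc] := multiplier_rule (psd_cone_conic A Q) psd_cone_symmetric
  (fun x => @excess_ge0 A Q x Amin QE).
(* The factor [1 - i] encodes the entry constraints, because the real part of [(u + i v) (1 - i)] is
   [u + v]. The hermitian part [H] of [G] has the same real trace pairing with hermitian
   matrices. *)
pose G : 'M[R[i]]_n.+1 := \matrix_(b, a) ((c (inr (a, b)))%:C * (1 -i* 1)).
pose H := (2^-1 : R)%:C *: (G + G ^t*).
have GabE a b : G b a = (c (inr (a, b)))%:C * (1 -i* 1) by rewrite mxE.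
have GE x : \sum_k c (inr k) * ds_constraint (inr k) x =
    complex.Re (\tr (ds_defect x *m G)).
  rewrite /mxtrace Re_sum; under [RHS]eq_bigr => a _ do rewrite mxE Re_sum.
  rewrite pair_bigA; apply: eq_bigr => -[a b] _; rewrite GabE mulrCA ReZ /=.
  by case: (ds_defect x a b) => u v /=; rewrite !mulr1 mulrN1 opprK.
have HE M : M ^t* = M -> complex.Re (\tr (M *m G)) = complex.Re (\tr (M *m H)).
  move=> hM; rewrite -scalemxAr mulmxDr linearZ linearD /= ReZ ReD.
  by rewrite -[in X in _ + X]hM trace_mulC_conj Re_conjc; lra.
have hH : H ^t* = H by rewrite adjmxZ adjmxD adjmxK addrC.
clearbody H; exists H, (fun i => c (inl i)) => P; split=> // x Kx.
have [[_ trA sumA] _] := Amin.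
have valE (X : 'I_n.+1 -> 'M[R[i]]_n.+1) :
    complex.Re (\sum_i \tr (X i *m P i)) =
    complex.Re (\sum_i \tr (X i *m Q i)) +
    \sum_i c (inl i) * complex.Re (\tr (X i)) +
    complex.Re (\tr ((\sum_i X i) *m H)).
  have -> : \tr ((\sum_i X i) *m H) = \sum_i \tr (X i *m H).
    by rewrite mulmx_suml raddf_sum.
  rewrite !Re_sum -!big_split /=; apply: eq_bigr => i _.
  by rewrite !mulmxDr mul_mx_scalar !linearD linearZ /= ReZ.
(* The terms in [x.2] add up to the value of the form at [A], because each [A i] has trace 1 and the
   [A i] sum to the identity. *)
have := hc x Kx; rewrite big_sumType /= GE HE; last exact: ds_defect_herm.
rewrite /excess /ds_defect !valE.
rewrite mulmxBl mul_scalar_mx linearB linearZ /= ReB ReZ sumA mul1mx.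
have -> : \sum_i c (inl i) * (complex.Re (\tr (x.1 i)) - x.2) =
    \sum_i c (inl i) * complex.Re (\tr (x.1 i)) - (\sum_i c (inl i)) * x.2.
  by rewrite mulr_suml -sumrB; apply: eq_bigr => i _; rewrite mulrBr.
have -> : \sum_i c (inl i) * complex.Re (\tr (A i)) = \sum_i c (inl i).
  by apply: eq_bigr => i _; rewrite trA mulr1.
by move=> h; rewrite -subr_ge0; move: h; congr (0 <= _); ring.
Qed.

End Lagrange.

(** * Extraction of the decomposition from the multiplier inequality *)

Theorem theorem3p4 (R : realType) (n : nat) (A Q : 'I_n -> 'M[R[i]]_n)
    (Amin : local_minimizer_mixed_disc A)
    (QE : forall i : 'I_n, is_mixed_grad A i (Q i)) :
  exists (H : 'M[R[i]]_n) (mu : 'I_n -> R) (P : 'I_n -> 'M[R[i]]_n),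
    H \is hermsymmx /\
    forall i : 'I_n,
      [/\ Q i = H + ((mu i)%:C)%:M + P i,
          psdmx (P i),
          A i *m P i = 0
        & P i *m A i = 0].
Proof.
(* In size 0 there is no index [i], and any hermitian matrix will do. *)
case: n A Q Amin QE => [|n] A Q Amin QE.
  exists 0, (fun=> 0), (fun=> 0); split; last by case.
  by apply/hermP; rewrite trmx0 map_mx0.
have [H [c]] := lagrange_multipliers Amin QE.
pose P i := Q i + (c i)%:C%:M + H => /= -[hH hx].
have [[psdA _ _] _] := Amin.
have hP i : (P i) ^t* = P i.
  rewrite !adjmxD adjmx_scalar hH (mixed_grad_herm _ (QE i)) // => j.
  exact: psdmx_herm.
have Ppos i X : psdmx X -> 0 <= complex.Re (\tr (X *m P i)).
  move=> psdX.
  (* With [tau = 0] and a single nonzero slot, the inequality isolates the pairing of [X] with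
     [P i]. *)
  have Kx : psd_cone (fun j => if j == i then X else 0, 0).
    split=> [j|]; last exact: lexx.
    change (psdmx (if j == i then X else 0)).
    by case: eqP => _; [exact: psdX | exact: psdmx0].
  have := hx _ Kx; rewrite /= mul0r (bigD1 i) //= eqxx big1 ?addr0 // => j ji.
  by rewrite (negbTE ji) mul0mx linear0.
have PA0 i : complex.Re (\tr (A i *m P i)) = 0.
  have le0 : \sum_j complex.Re (\tr (A j *m P j)) <= 0.
    (* The zero tuple with [tau = 1] gives the reverse inequality, so a sum of nonnegative terms is
       zero and each term vanishes. *)
    have := hx (fun=> 0, 1) (conj (fun=> psdmx0 _ _) ler01).
    rewrite /= mul1r Re_sum [X in _ <= complex.Re X]big1 // => j _.
    by rewrite mul0mx linear0.
  apply/eqP; have : \sum_j complex.Re (\tr (A j *m P j)) == 0.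
    by rewrite eq_le le0 sumr_ge0 // => j _; apply: Ppos.
  rewrite psumr_eq0 => [/allP h|j _]; last exact: Ppos.
  exact: h i (mem_index_enum i).
have AP i : A i *m P i = 0.
  exact: (psd_annihilates (psdA i) (hP i) (Ppos i) (PA0 i)).
exists (- H), (fun i => - c i), P; split=> [|i].
  by apply/hermP; rewrite adjmxN hH.
split=> //.
- by rewrite /P !rmorphN /= [RHS]addrC addrA addrK addrK.
(* The quadratic form of [P i] at [x] is its trace pairing with the rank one matrix built from
   [x]. *)
- apply: psdmxI => // x; have := Ppos i _ (psdmx_outer x).
  by rewrite -mulmxA mxtrace_mulC /mxtrace big_ord1.
- by rewrite -[LHS]adjmxK adjmxM hP psdmx_herm // AP trmx0 map_mx0.
Qed.
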